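(* Let $T$ be a tree, let $\mu$ be a positive function on $T$, and let $\varphi$ be a self-map of $T$. If $C_\varphi$ is an isometry on $L_\mu^\infty$, then $\varphi$ is surjective and $\sup_{v \in T} \frac{\mu(v)}{\mu(\varphi(v))} = 1$.
   Context: A tree $T$ is a locally finite, connected, simply-connected graph, identified as a set with its set of vertices; it is assumed to have no terminal vertices (a vertex is terminal if it has a unique neighbor), hence to be infinite, and it is rooted at a vertex $o$. A function on $T$ is a complex-valued function on the set of vertices. For a positive function $\mu: T \to (0,\infty)$ (the weight), $L_\mu^\infty$ is the Banach space of all functions $f$ on $T$ with $\|f\|_\mu = \sup_{v \in T} \mu(v)|f(v)| < \infty$. For an arbitrary self-map $\varphi$ of (the vertex set of) $T$, the composition operator is $C_\varphi f = f \circ \varphi$. It is an isometry on $L_\mu^\infty$ if it maps $L_\mu^\infty$ into itself and $\|C_\varphi f\|_\mu = \|f\|_\mu$ for all $f \in L_\mu^\infty$ (surjectivity is not required). *)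

(* Defs.v *)
From HB Require Import structures.
From mathcomp Require Import all_boot all_order all_algebra.
From mathcomp Require Import complex.
From mathcomp Require Import all_classical all_reals all_analysis.

Set Implicit Arguments.
Unset Strict Implicit.
Unset Printing Implicit Defensive.

Import Order.TTheory GRing.Theory Num.Theory.

Local Open Scope classical_set_scope.
Local Open Scope ring_scope.
Local Open Scope complex_scope.

(* Simple connectivity of a (simple) graph is the absence of cycles with at   *)
(* least three distinct vertices. A vertex is terminal if it has a unique     *)
(* neighbor; the one-vertex graph has no terminal vertex in this sense, so    *)
(* infiniteness is required separately.                                       *)
Record tree := Tree {
  tree_vertex :> choiceType;
  tree_adj : rel tree_vertex;
  tree_root : tree_vertex;
  tree_adj_sym : symmetric tree_adj;
  tree_adj_irr : irreflexive tree_adj;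
  tree_locally_finite : forall v, finite_set [set w | tree_adj v w];
  tree_connected : forall v w, exists2 p, path tree_adj v p & last v p = w;
  tree_acyclic : forall c, (2 < size c)%N -> ~ ucycle tree_adj c;
  tree_no_terminal : forall v, ~ exists! w, tree_adj v w;
  tree_infinite : infinite_set [set: tree_vertex] }.

(* The weighted norm is extended-real valued, so that it is defined for every *)
(* function; it is the usual norm on Linf.                                    *)
Definition weighted_norm (R : realType) (T : tree) (mu : T -> R)
    (f : T -> R[i]) : \bar R :=
  ereal_sup (range (fun v => (mu v * ComplexField.Normc.normc (f v))%:E)).

Definition Linf (R : realType) (T : tree) (mu : T -> R) : set (T -> R[i]) :=
  [set f | (weighted_norm mu f < +oo)%E].

Definition composition_operator (R : realType) (T : tree) (phi : T -> T)
    (f : T -> R[i]) : T -> R[i] := f \o phi.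

Definition isometry_on_Linf (R : realType) (T : tree) (mu : T -> R)
    (A : (T -> R[i]) -> (T -> R[i])) : Prop :=
  (forall f, Linf mu f -> Linf mu (A f)) /\
  (forall f, Linf mu f -> weighted_norm mu (A f) = weighted_norm mu f).

(* Main.v *)
Require Import Defs.
From HB Require Import structures.
From mathcomp Require Import all_boot all_order all_algebra.
From mathcomp Require Import complex.
From mathcomp Require Import all_classical all_reals all_analysis.

(** It suffices to apply the isometry to the indicators of vertices and to the
    function [1 / mu].

    The indicator of a vertex [w] has norm [mu w > 0].  Composing it with [phi]
    gives the indicator of the fibre of [phi] over [w], so an empty fibre would
    send a function of positive norm to [0]; hence [phi] is surjective.

    The function [1 / mu] has norm [1], every vertex contributing exactly [1] to
    the supremum, and the norm of its image [1 / (mu \o phi)] is by definition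
    the supremum of [mu v / mu (phi v)]. *)

Set Implicit Arguments.
Unset Strict Implicit.
Unset Printing Implicit Defensive.

Import Order.TTheory GRing.Theory Num.Theory.

Local Open Scope classical_set_scope.
Local Open Scope ring_scope.

Lemma weighted_norm_nonneg_real (R : realType) (T : tree) (mu h : T -> R)
    (h_ge0 : forall v, 0 <= h v) :
  weighted_norm mu (fun v => (h v)%:C%C) =
  ereal_sup (range (fun v => (mu v * h v)%:E)).
Proof.
rewrite /weighted_norm; congr ereal_sup; apply: eq_imagel => v _.
congr (_ * _)%:E.
by rewrite /= expr0n addr0 sqrtr_sqr ger0_norm.
Qed.

Lemma ereal_sup_range_cst (R : realType) (T : tree) (c : \bar R) :
  ereal_sup (range (fun _ : T => c)) = c.
Proof.
by apply: ereal_sup_cst; apply/set0P; exists (tree_root T).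
Qed.

Lemma weighted_norm_indicator (R : realType) (T : tree) (mu : T -> R)
    (mu_gt0 : forall v, 0 < mu v) (w : T) :
  weighted_norm mu (fun v => ((v == w)%:R : R)%:C%C) = (mu w)%:E.
Proof.
rewrite weighted_norm_nonneg_real //; apply/eqP; rewrite eq_le; apply/andP; split.
  apply: ge_ereal_sup => _ [v _ <-]; rewrite lee_fin.
  by case: eqP => [->|_]; rewrite ?mulr1 // mulr0 ltW.
by apply: ereal_sup_ubound; exists w; rewrite // eqxx mulr1.
Qed.

Lemma weighted_norm_inv_weight (R : realType) (T : tree) (mu : T -> R)
    (mu_gt0 : forall v, 0 < mu v) :
  weighted_norm mu (fun v => (mu v)^-1%:C%C) = 1%:E.
Proof.
rewrite weighted_norm_nonneg_real => [|v]; last by rewrite invr_ge0 ltW.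
under eq_fun do rewrite divff ?gt_eqF //.
exact: ereal_sup_range_cst.
Qed.

Theorem theorem5p2 (R : realType) (T : tree) (mu : T -> R)
    (mu_gt0 : forall v, 0 < mu v) (phi : T -> T)
    (phi_isometry :
       isometry_on_Linf mu (@composition_operator R T phi)) :
  (forall w, exists v, phi v = w) /\
  ereal_sup (range (fun v => (mu v / mu (phi v))%:E)) = 1%:E.
Proof.
case: phi_isometry => _ isom; split=> [w|].
- apply: contrapT => fibre0.
  have := isom (fun v => ((v == w)%:R : R)%:C%C).
  rewrite /Linf /= weighted_norm_indicator // ltry => /(_ isT).
  rewrite /composition_operator /comp weighted_norm_nonneg_real //.
  have phi_neq v : (phi v == w) = false.
    by apply/eqP => phi_v; apply: fibre0; exists v.
  under eq_fun do rewrite phi_neq mulr0.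
  by rewrite ereal_sup_range_cst => -[mu_w]; have := mu_gt0 w; rewrite -mu_w ltxx.
- have := isom (fun v => (mu v)^-1%:C%C).
  rewrite /Linf /= weighted_norm_inv_weight // ltry => /(_ isT).
  rewrite /composition_operator /comp weighted_norm_nonneg_real // => v.
  by rewrite invr_ge0 ltW.
Qed.
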